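(* For every commutative monoid $M$, $m_M\circ\nabla_{FM}=\nabla_M\circ(m_M\otimes m_M)$ as maps $FFM\otimes FFM\to FM$.
   Context: $\otimes$ is the tensor product of commutative monoids (universal for maps that are additive and zero-preserving in each variable). For a commutative monoid $(M,+,0)$, let $F_0M$ be the set of formal expressions freely generated inductively by: $0$; $1$; $x_m$ for each $m\in M$; $(a+b)$ and $(ab)$ for $a,b\in F_0M$; $f(a)$ for $a\in F_0M$. Let $\sim$ be the smallest equivalence relation on $F_0M$ such that for all $a,b,c\in F_0M$ and $m,n\in M$: $((a+b)+c)\sim(a+(b+c))$; $(a+0)\sim a$; $(a+b)\sim(b+a)$; $((ab)c)\sim(a(bc))$; $(a1)\sim a$; $(ab)\sim(ba)$; $((a+b)c)\sim((ac)+(bc))$; $(0a)\sim 0$; $x_0\sim 0$; $(x_m+x_n)\sim x_{m+n}$; and $a\sim b$ implies $(a+c)\sim(b+c)$, $(ac)\sim(bc)$, $f(a)\sim f(b)$. Set $FM:=F_0M/\sim$, with $[a]$ the class of $a$; it is a commutative rig (commutative semiring with $0$ and $1$) with $[a]+[b]=[(a+b)]$, $[a][b]=[(ab)]$, zero $[0]$, unit $[1]$, and self-map $\mathbf{f}([a])=[f(a)]$; it is viewed as a commutative monoid under $+$. $FM$ is the free commutative rig with a self-map on $M$, and $F$ is the underlying functor of the resulting monad on commutative monoids, with multiplication $m_M\colon FFM\to FM$. Explicitly, $m_M$ is the unique rig homomorphism commuting with the self-maps of $FFM$ and $FM$ and sending, for each $[a]\in FM$, the generator of $FFM$ indexed by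 $[a]$ to $[a]$. $\nabla_M\colon FM\otimes FM\to FM$ is the unique monoid homomorphism with $\nabla_M([a]\otimes[b])=[a][b]$ for all $[a],[b]\in FM$; $\nabla_{FM}$ is the same map for the commutative monoid $FM$ in place of $M$. *)

(* Defs.v *)
From HB Require Import structures.
From mathcomp Require Import all_boot all_algebra.
From mathcomp Require Import boolp.

Set Implicit Arguments.
Unset Strict Implicit.
Unset Printing Implicit Defensive.

Import GRing.Theory.
Local Open Scope ring_scope.
Local Open Scope quotient_scope.

(* Commutative monoids are nmodTypes and their homomorphisms are
   {additive _ -> _}; commutative rigs are comPzSemiRingTypes and their
   homomorphisms are {rmorphism _ -> _}.  The choice structures that
   nmodType asks for come from classical choice (boolp). *)

Section Tensor.
Variables A B : nmodType.

Inductive tensor_expr : Type :=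
| TZero
| TPure of A & B
| TAdd of tensor_expr & tensor_expr.

HB.instance Definition _ := gen_eqMixin tensor_expr.
HB.instance Definition _ := gen_choiceMixin tensor_expr.

Inductive tensor_eqv : tensor_expr -> tensor_expr -> Prop :=
| teqv_refl s : tensor_eqv s s
| teqv_sym s t : tensor_eqv s t -> tensor_eqv t s
| teqv_trans s t u : tensor_eqv s t -> tensor_eqv t u -> tensor_eqv s u
| teqv_addA s t u : tensor_eqv (TAdd (TAdd s t) u) (TAdd s (TAdd t u))
| teqv_addC s t : tensor_eqv (TAdd s t) (TAdd t s)
| teqv_add0 s : tensor_eqv (TAdd s TZero) s
| teqv_add s t u : tensor_eqv s t -> tensor_eqv (TAdd s u) (TAdd t u)
| teqv_pure0l b : tensor_eqv (TPure 0 b) TZero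
| teqv_pure0r a : tensor_eqv (TPure a 0) TZero
| teqv_pureDl a a' b :
    tensor_eqv (TPure (a + a') b) (TAdd (TPure a b) (TPure a' b))
| teqv_pureDr a b b' :
    tensor_eqv (TPure a (b + b')) (TAdd (TPure a b) (TPure a b')).

Definition tensor_eqvb : rel tensor_expr := fun s t => `[< tensor_eqv s t >].

Lemma tensor_eqvb_refl : reflexive tensor_eqvb.
Proof. by move=> s; apply/asboolP; apply: teqv_refl. Qed.

Lemma tensor_eqvb_sym : symmetric tensor_eqvb.
Proof. by move=> s t; apply/asboolP/asboolP => /teqv_sym. Qed.

Lemma tensor_eqvb_trans : transitive tensor_eqvb.
Proof.
move=> t s u /asboolP st /asboolP tu; apply/asboolP.
exact: teqv_trans st tu.
Qed.

Canonical tensor_eqv_equiv :=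
  EquivRel tensor_eqvb tensor_eqvb_refl tensor_eqvb_sym tensor_eqvb_trans.

Definition tensor := {eq_quot tensor_eqvb}.

HB.instance Definition _ := Choice.on tensor.

Definition tensor_class (s : tensor_expr) : tensor := \pi_{eq_quot tensor_eqvb} s.

Definition tensor_repr (x : tensor) : tensor_expr :=
  repr (x : {eq_quot tensor_eqvb}).

Lemma tensor_reprK x : tensor_class (tensor_repr x) = x.
Proof. exact: reprK. Qed.

Lemma tensor_classP s t : tensor_class s = tensor_class t <-> tensor_eqv s t.
Proof.
split=> [/(@eqmodP _ tensor_eqv_equiv) /asboolP //|st].
by apply/(@eqmodP _ tensor_eqv_equiv)/asboolP.
Qed.

Lemma tensor_repr_class s : tensor_eqv (tensor_repr (tensor_class s)) s.
Proof. by apply/tensor_classP; rewrite tensor_reprK. Qed.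

Definition tensor_add (x y : tensor) : tensor :=
  tensor_class (TAdd (tensor_repr x) (tensor_repr y)).

Lemma tensor_add_class s t :
  tensor_add (tensor_class s) (tensor_class t) = tensor_class (TAdd s t).
Proof.
apply/tensor_classP; apply: teqv_trans (teqv_add _ (tensor_repr_class s)) _.
apply: teqv_trans (teqv_addC _ _) _; apply: teqv_trans (teqv_addC t s).
exact: teqv_add (tensor_repr_class t).
Qed.

Lemma tensor_addA : associative tensor_add.
Proof.
move=> x y z; rewrite -(tensor_reprK x) -(tensor_reprK y) -(tensor_reprK z).
rewrite !tensor_add_class; apply/tensor_classP/teqv_sym; exact: teqv_addA.
Qed.

Lemma tensor_addC : commutative tensor_add.
Proof.
move=> x y; rewrite -(tensor_reprK x) -(tensor_reprK y).
rewrite !tensor_add_class; apply/tensor_classP; exact: teqv_addC.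
Qed.

Lemma tensor_add0 : left_id (tensor_class TZero) tensor_add.
Proof.
move=> x; rewrite tensor_addC -(tensor_reprK x) tensor_add_class.
by apply/tensor_classP; apply: teqv_add0.
Qed.

HB.instance Definition _ :=
  GRing.isNmodule.Build tensor tensor_addA tensor_addC tensor_add0.

Lemma tensor_class0 : tensor_class TZero = 0. Proof. by []. Qed.

Lemma tensor_classD s t :
  tensor_class (TAdd s t) = tensor_class s + tensor_class t.
Proof. by rewrite -tensor_add_class. Qed.

Definition pure (a : A) (b : B) : tensor := tensor_class (TPure a b).

Lemma pure0l b : pure 0 b = 0.
Proof. by apply/tensor_classP; apply: teqv_pure0l. Qed.

Lemma pure0r a : pure a 0 = 0.
Proof. by apply/tensor_classP; apply: teqv_pure0r. Qed.

Lemma pureDl a a' b : pure (a + a') b = pure a b + pure a' b.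
Proof.
rewrite -tensor_classD; apply/tensor_classP; exact: teqv_pureDl.
Qed.

Lemma pureDr a b b' : pure a (b + b') = pure a b + pure a b'.
Proof.
rewrite -tensor_classD; apply/tensor_classP; exact: teqv_pureDr.
Qed.

Definition biadditive (C : nmodType) (h : A -> B -> C) : Prop :=
  (forall b, nmod_morphism (h^~ b)) /\ (forall a, nmod_morphism (h a)).

Section Lift.
Variables (C : nmodType) (h : A -> B -> C) (hh : biadditive h).

Fixpoint tensor_eval (s : tensor_expr) : C :=
  match s with
  | TZero => 0
  | TPure a b => h a b
  | TAdd s t => tensor_eval s + tensor_eval t
  end.

Lemma tensor_eval_eqv s t : tensor_eqv s t -> tensor_eval s = tensor_eval t.
Proof.
have [hl hr] := hh.
elim=> //= {s t}.
- by move=> s t u _ -> _ ->.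
- by move=> s t u; rewrite addrA.
- by move=> s t; rewrite addrC.
- by move=> s; rewrite addr0.
- by move=> s t u _ ->.
- by move=> b; rewrite (hl b).1.
- by move=> a; rewrite (hr a).1.
- by move=> a a' b; rewrite (hl b).2.
- by move=> a b b'; rewrite (hr a).2.
Qed.

(* The proof is an argument so that the additive instance can be inferred. *)
Definition tensor_lift of biadditive h := fun x => tensor_eval (tensor_repr x).

Lemma tensor_lift_class s : tensor_lift hh (tensor_class s) = tensor_eval s.
Proof. exact: tensor_eval_eqv (tensor_repr_class s). Qed.

Lemma tensor_lift_is_nmod_morphism : nmod_morphism (tensor_lift hh).
Proof.
split=> [|x y]; first exact: tensor_lift_class.
rewrite -(tensor_reprK x) -(tensor_reprK y) -tensor_classD.
by rewrite !tensor_lift_class.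
Qed.

HB.instance Definition _ := GRing.isNmodMorphism.Build tensor C
  (tensor_lift hh) tensor_lift_is_nmod_morphism.

Lemma tensor_lift_pure a b : tensor_lift hh (pure a b) = h a b.
Proof. exact: tensor_lift_class. Qed.

End Lift.

Lemma tensor_additive_eq (C : nmodType) (g g' : {additive tensor -> C}) :
  (forall a b, g (pure a b) = g' (pure a b)) -> g =1 g'.
Proof.
move=> gg' x; rewrite -(tensor_reprK x).
elim: (tensor_repr x) => [|a b|s IHs t IHt].
- by rewrite tensor_class0 !raddf0.
- exact: gg'.
- by rewrite tensor_classD !raddfD IHs IHt.
Qed.

End Tensor.

Lemma tensor_map_biadditive (A A' B B' : nmodType)
    (g : {additive A -> A'}) (h : {additive B -> B'}) :
  biadditive (fun a b => pure (g a) (h b)).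
Proof.
split=> [b|a]; split=> [|x y] /=; rewrite ?raddf0 ?raddfD.
- exact: pure0l.
- exact: pureDl.
- exact: pure0r.
- exact: pureDr.
Qed.

Definition tensor_map (A A' B B' : nmodType)
    (g : {additive A -> A'}) (h : {additive B -> B'}) :
    {additive tensor A B -> tensor A' B'} :=
  tensor_lift (tensor_map_biadditive g h).

Lemma tensor_map_pure (A A' B B' : nmodType)
    (g : {additive A -> A'}) (h : {additive B -> B'}) a b :
  tensor_map g h (pure a b) = pure (g a) (h b).
Proof. exact: tensor_lift_pure. Qed.

Section FreeRig.
Variable M : nmodType.

Inductive rig_expr : Type :=
| EZero
| EOne
| EVar of M
| EAdd of rig_expr & rig_expr
| EMul of rig_expr & rig_expr
| EMap of rig_expr.

HB.instance Definition _ := gen_eqMixin rig_expr.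
HB.instance Definition _ := gen_choiceMixin rig_expr.

Inductive rig_eqv : rig_expr -> rig_expr -> Prop :=
| reqv_refl a : rig_eqv a a
| reqv_sym a b : rig_eqv a b -> rig_eqv b a
| reqv_trans a b c : rig_eqv a b -> rig_eqv b c -> rig_eqv a c
| reqv_addA a b c : rig_eqv (EAdd (EAdd a b) c) (EAdd a (EAdd b c))
| reqv_add0 a : rig_eqv (EAdd a EZero) a
| reqv_addC a b : rig_eqv (EAdd a b) (EAdd b a)
| reqv_mulA a b c : rig_eqv (EMul (EMul a b) c) (EMul a (EMul b c))
| reqv_mul1 a : rig_eqv (EMul a EOne) a
| reqv_mulC a b : rig_eqv (EMul a b) (EMul b a)
| reqv_mulDl a b c :
    rig_eqv (EMul (EAdd a b) c) (EAdd (EMul a c) (EMul b c))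
| reqv_mul0 a : rig_eqv (EMul EZero a) EZero
| reqv_var0 : rig_eqv (EVar 0) EZero
| reqv_varD m n : rig_eqv (EAdd (EVar m) (EVar n)) (EVar (m + n))
| reqv_add a b c : rig_eqv a b -> rig_eqv (EAdd a c) (EAdd b c)
| reqv_mul a b c : rig_eqv a b -> rig_eqv (EMul a c) (EMul b c)
| reqv_map a b : rig_eqv a b -> rig_eqv (EMap a) (EMap b).

Definition rig_eqvb : rel rig_expr := fun a b => `[< rig_eqv a b >].

Lemma rig_eqvb_refl : reflexive rig_eqvb.
Proof. by move=> a; apply/asboolP; apply: reqv_refl. Qed.

Lemma rig_eqvb_sym : symmetric rig_eqvb.
Proof. by move=> a b; apply/asboolP/asboolP => /reqv_sym. Qed.

Lemma rig_eqvb_trans : transitive rig_eqvb.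
Proof.
move=> b a c /asboolP ab /asboolP bc; apply/asboolP.
exact: reqv_trans ab bc.
Qed.

Canonical rig_eqv_equiv :=
  EquivRel rig_eqvb rig_eqvb_refl rig_eqvb_sym rig_eqvb_trans.

Definition free_rig := {eq_quot rig_eqvb}.

HB.instance Definition _ := Choice.on free_rig.

Definition rig_class (a : rig_expr) : free_rig := \pi_{eq_quot rig_eqvb} a.

Definition rig_repr (x : free_rig) : rig_expr := repr (x : {eq_quot rig_eqvb}).

Lemma rig_reprK x : rig_class (rig_repr x) = x.
Proof. exact: reprK. Qed.

Lemma rig_classP a b : rig_class a = rig_class b <-> rig_eqv a b.
Proof.
split=> [/(@eqmodP _ rig_eqv_equiv) /asboolP //|ab].
by apply/(@eqmodP _ rig_eqv_equiv)/asboolP.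
Qed.

Lemma rig_repr_class a : rig_eqv (rig_repr (rig_class a)) a.
Proof. by apply/rig_classP; rewrite rig_reprK. Qed.

Definition rig_add (x y : free_rig) : free_rig :=
  rig_class (EAdd (rig_repr x) (rig_repr y)).

Definition rig_mul (x y : free_rig) : free_rig :=
  rig_class (EMul (rig_repr x) (rig_repr y)).

Lemma rig_add_class a b :
  rig_add (rig_class a) (rig_class b) = rig_class (EAdd a b).
Proof.
apply/rig_classP; apply: reqv_trans (reqv_add _ (rig_repr_class a)) _.
apply: reqv_trans (reqv_addC _ _) _; apply: reqv_trans (reqv_addC b a).
exact: reqv_add (rig_repr_class b).
Qed.

Lemma rig_mul_class a b :
  rig_mul (rig_class a) (rig_class b) = rig_class (EMul a b).
Proof.
apply/rig_classP; apply: reqv_trans (reqv_mul _ (rig_repr_class a)) _.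
apply: reqv_trans (reqv_mulC _ _) _; apply: reqv_trans (reqv_mulC b a).
exact: reqv_mul (rig_repr_class b).
Qed.

Lemma rig_addA : associative rig_add.
Proof.
move=> x y z; rewrite -(rig_reprK x) -(rig_reprK y) -(rig_reprK z).
rewrite !rig_add_class; apply/rig_classP/reqv_sym; exact: reqv_addA.
Qed.

Lemma rig_addC : commutative rig_add.
Proof.
move=> x y; rewrite -(rig_reprK x) -(rig_reprK y).
rewrite !rig_add_class; apply/rig_classP; exact: reqv_addC.
Qed.

Lemma rig_add0 : left_id (rig_class EZero) rig_add.
Proof.
move=> x; rewrite rig_addC -(rig_reprK x) rig_add_class.
by apply/rig_classP; apply: reqv_add0.
Qed.

HB.instance Definition _ :=
  GRing.isNmodule.Build free_rig rig_addA rig_addC rig_add0.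

Lemma rig_classD a b : rig_class (EAdd a b) = rig_class a + rig_class b.
Proof. by rewrite -rig_add_class. Qed.

Lemma rig_mulA : associative rig_mul.
Proof.
move=> x y z; rewrite -(rig_reprK x) -(rig_reprK y) -(rig_reprK z).
rewrite !rig_mul_class; apply/rig_classP/reqv_sym; exact: reqv_mulA.
Qed.

Lemma rig_mulC : commutative rig_mul.
Proof.
move=> x y; rewrite -(rig_reprK x) -(rig_reprK y).
rewrite !rig_mul_class; apply/rig_classP; exact: reqv_mulC.
Qed.

Lemma rig_mul1 : left_id (rig_class EOne) rig_mul.
Proof.
move=> x; rewrite rig_mulC -(rig_reprK x) rig_mul_class.
by apply/rig_classP; apply: reqv_mul1.
Qed.

Lemma rig_mulDl : left_distributive rig_mul +%R.
Proof.
move=> x y z; rewrite -(rig_reprK x) -(rig_reprK y) -(rig_reprK z).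
rewrite -rig_classD !rig_mul_class -rig_classD.
by apply/rig_classP; apply: reqv_mulDl.
Qed.

Lemma rig_mul0 : left_zero 0 rig_mul.
Proof.
move=> x; rewrite -(rig_reprK x) [LHS]rig_mul_class.
by apply/rig_classP; apply: reqv_mul0.
Qed.

HB.instance Definition _ := GRing.Nmodule_isComPzSemiRing.Build free_rig
  rig_mulA rig_mulC rig_mul1 rig_mulDl rig_mul0.

Definition selfmap (x : free_rig) : free_rig := rig_class (EMap (rig_repr x)).

Definition rig_var (m : M) : free_rig := rig_class (EVar m).

Lemma rig_class0 : rig_class EZero = 0. Proof. by []. Qed.

Lemma rig_class1 : rig_class EOne = 1. Proof. by []. Qed.

Lemma rig_classM a b : rig_class (EMul a b) = rig_class a * rig_class b.
Proof. by rewrite -rig_mul_class. Qed.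

Lemma rig_class_map a : rig_class (EMap a) = selfmap (rig_class a).
Proof. by apply/rig_classP; apply/reqv_map/reqv_sym/rig_repr_class. Qed.

Lemma rig_var_is_nmod_morphism : nmod_morphism rig_var.
Proof.
split=> [|m n]; first by apply/rig_classP; apply: reqv_var0.
by rewrite -rig_classD; apply/rig_classP/reqv_sym/reqv_varD.
Qed.

HB.instance Definition _ :=
  GRing.isNmodMorphism.Build M free_rig rig_var rig_var_is_nmod_morphism.

Section Lift.
Variables (R : comPzSemiRingType) (f : R -> R) (h : {additive M -> R}).

Fixpoint rig_eval (a : rig_expr) : R :=
  match a with
  | EZero => 0
  | EOne => 1
  | EVar m => h m
  | EAdd a b => rig_eval a + rig_eval b
  | EMul a b => rig_eval a * rig_eval b
  | EMap a => f (rig_eval a)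
  end.

Lemma rig_eval_eqv a b : rig_eqv a b -> rig_eval a = rig_eval b.
Proof.
elim=> {a b} /=.
- by [].
- by move=> a b _ ->.
- by move=> a b c _ -> _ ->.
- by move=> a b c; rewrite addrA.
- by move=> a; rewrite addr0.
- by move=> a b; rewrite addrC.
- by move=> a b c; rewrite mulrA.
- by move=> a; rewrite mulr1.
- by move=> a b; rewrite mulrC.
- by move=> a b c; rewrite mulrDl.
- by move=> a; rewrite mul0r.
- by rewrite raddf0.
- by move=> m n; rewrite raddfD.
- by move=> a b c _ ->.
- by move=> a b c _ ->.
- by move=> a b _ ->.
Qed.

Definition rig_lift (x : free_rig) : R := rig_eval (rig_repr x).

Lemma rig_lift_class a : rig_lift (rig_class a) = rig_eval a.
Proof. exact: rig_eval_eqv (rig_repr_class a). Qed.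

Lemma rig_lift_is_nmod_morphism : nmod_morphism rig_lift.
Proof.
split=> [|x y]; first by rewrite -rig_class0 rig_lift_class.
rewrite -(rig_reprK x) -(rig_reprK y) -rig_classD.
by rewrite !rig_lift_class.
Qed.

Lemma rig_lift_is_monoid_morphism : monoid_morphism rig_lift.
Proof.
split=> [|x y]; first by rewrite -rig_class1 rig_lift_class.
rewrite -(rig_reprK x) -(rig_reprK y) -rig_classM.
by rewrite !rig_lift_class.
Qed.

HB.instance Definition _ :=
  GRing.isNmodMorphism.Build free_rig R rig_lift rig_lift_is_nmod_morphism.
HB.instance Definition _ :=
  GRing.isMonoidMorphism.Build free_rig R rig_lift rig_lift_is_monoid_morphism.

Lemma rig_lift_var m : rig_lift (rig_var m) = h m.
Proof. exact: rig_lift_class. Qed.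

Lemma rig_lift_selfmap x : rig_lift (selfmap x) = f (rig_lift x).
Proof. by rewrite -(rig_reprK x) -rig_class_map !rig_lift_class. Qed.

Lemma rig_lift_unique (g : {rmorphism free_rig -> R}) :
    (forall x, g (selfmap x) = f (g x)) -> (forall m, g (rig_var m) = h m) ->
  g =1 rig_lift.
Proof.
move=> gf gv x; rewrite -(rig_reprK x) rig_lift_class.
elim: (rig_repr x) => /= [||m|a IHa b IHb|a IHa b IHb|a IHa].
- by rewrite rig_class0 rmorph0.
- by rewrite rig_class1 rmorph1.
- exact: gv.
- by rewrite rig_classD rmorphD IHa IHb.
- by rewrite rig_classM rmorphM IHa IHb.
- by rewrite rig_class_map gf IHa.
Qed.

End Lift.

Lemma mul_biadditive : biadditive (fun x y : free_rig => x * y).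
Proof.
split=> z; split=> [|x y] /=.
- exact: mul0r.
- exact: mulrDl.
- exact: mulr0.
- exact: mulrDr.
Qed.

Definition nabla : {additive tensor free_rig free_rig -> free_rig} :=
  tensor_lift mul_biadditive.

Lemma nabla_pure x y : nabla (pure x y) = x * y.
Proof. exact: tensor_lift_pure. Qed.

Lemma nabla_unique (g : {additive tensor free_rig free_rig -> free_rig}) :
  (forall x y, g (pure x y) = x * y) -> g =1 nabla.
Proof.
by move=> gM; apply: tensor_additive_eq => x y; rewrite gM nabla_pure.
Qed.

End FreeRig.

(* Multiplication of the monad M |-> free_rig M.  The identity is taken as an
   additive map out of the underlying monoid of free_rig M. *)
Definition monad_mul (M : nmodType) :
    {rmorphism free_rig (free_rig M) -> free_rig M} :=
  rig_lift (@selfmap M) idfun.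

Lemma monad_mul_var (M : nmodType) (x : free_rig M) :
  monad_mul M (rig_var x) = x.
Proof. exact: rig_lift_var. Qed.

Lemma monad_mul_selfmap (M : nmodType) (x : free_rig (free_rig M)) :
  monad_mul M (selfmap x) = selfmap (monad_mul M x).
Proof. exact: rig_lift_selfmap. Qed.

Lemma monad_mul_unique (M : nmodType)
    (g : {rmorphism free_rig (free_rig M) -> free_rig M}) :
    (forall x, g (selfmap x) = selfmap (g x)) -> (forall x, g (rig_var x) = x) ->
  g =1 monad_mul M.
Proof. by move=> gf gv; apply: (@rig_lift_unique _ _ (@selfmap M) idfun g). Qed.

(* Main.v *)
Require Import Defs.
From mathcomp Require Import all_boot all_algebra.
From mathcomp Require Import boolp.

(** Both sides are additive maps out of a tensor product, so they are equal
    as soon as they agree on pure tensors.  On [pure x y] the left side is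
    [m (x * y)] and the right side is [m x * m y], where [m] is the monad
    multiplication; these coincide because [m] preserves products, being a
    homomorphism of rigs and not merely of additive monoids. *)

Theorem proposition5p4 (M : nmodType) :
  monad_mul M \o nabla (free_rig M)
  = nabla M \o tensor_map (monad_mul M) (monad_mul M)
  :> (tensor (free_rig (free_rig M)) (free_rig (free_rig M)) -> free_rig M).
Proof.
apply/funext; apply: tensor_additive_eq => x y /=.
by rewrite nabla_pure tensor_map_pure nabla_pure GRing.rmorphM.
Qed.
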